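(* Let $\mathcal M$ be a compact $d$-rectifiable metric space (metric $\rho$, measure $\mu$ with $\mu(\mathcal M)=1$), witnessed by $\nu$, $\mathcal O$ and an injective Lipschitz map $f:\mathcal O\to\mathcal M$ with Lipschitz constant $\mathrm{Lip}(f)$. Then for each integer $N\ge1$ there exists an equal measure partition $\mathcal R_N$ of $\mathcal M$ into $N$ sets such that $$\|\mathcal R_N\|_1\le d\,2^{d-1}\,\mathrm{Lip}(f)\,N^{-\frac1d}.$$
   Context: $d$-rectifiability: there exist a measure $\nu$ on $I^d=[0,1]^d$ absolutely continuous with respect to Lebesgue measure, a measurable $\mathcal O\subset I^d$, and an injective map $f:\mathcal O\to\mathcal M$ with $\rho(f(Z_1),f(Z_2))\le c\|Z_1-Z_2\|$ for $Z_1,Z_2\in\mathcal O$ (Euclidean norm), such that $\mu(\mathcal M\setminus f(\mathcal O))=0$ and $\mu(E)=\nu(f^{-1}(E\cap f(\mathcal O)))$ for every $\mu$-measurable $E\subset\mathcal M$; $\mathrm{Lip}(f)$ is the least such $c$. An equal measure partition of $\mathcal M$ is a family of measurable $V_1,\dots,V_N$ with $\mu(\mathcal M\setminus\bigcup V_i)=0$, $\mu(V_i\cap V_j)=0$ ($i\ne j$) and $\mu(V_i)=1/N$; its average diameter is $\|\mathcal R_N\|_1=\frac1N\sum_i\mathrm{diam}(\rho,V_i)$ with $\mathrm{diam}(\rho,V)=\sup\{\rho(y_1,y_2):y_1,y_2\in V\}$. *)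

(* Defs.v *)
From HB Require Import structures.
From mathcomp Require Import all_boot all_order all_algebra.
From mathcomp Require Import all_classical all_reals all_analysis.

Set Implicit Arguments.
Unset Strict Implicit.
Unset Printing Implicit Defensive.

Import Order.TTheory GRing.Theory Num.Theory.
Import numFieldNormedType.Exports.

Local Open Scope classical_set_scope.
Local Open Scope ring_scope.

(* A metric space with a sigma-algebra. No relation between the two is imposed
   here; that open sets are measurable is a separate hypothesis. Every
   measurableType is pointed, which is harmless for a space of measure 1. *)
#[short(type="measurableMetricType")]
HB.structure Definition MeasurableMetric (d : measure_display) (R : realType) :=
  { T of Metric R T & Measurable d T }.

Section euclidean_space.
Context {R : realType} {d : nat}.
Implicit Types (a b x : 'rV[R]_d) (A : set 'rV[R]_d).

(* The norm that MathComp-Analysis puts on 'rV[R]_d is the sup norm. *)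
Definition euclidean_norm x : R := Num.sqrt (\sum_i x 0 i ^+ 2).

Definition box a b : set 'rV[R]_d :=
  [set x | forall i, a 0 i <= x 0 i <= b 0 i].

Definition box_volume a b : R := \prod_i (b 0 i - a 0 i).

Definition unit_cube : set 'rV[R]_d := box (const_mx 0) (const_mx 1).

(* The index set D makes the cover finite or countable: a closed box is never
   empty, so in dimension 0 the empty set is covered only with D = set0. *)
Definition lebesgue_outer A : \bar R :=
  ereal_inf [set s | exists (D : set nat) (a b : nat -> 'rV[R]_d),
    [/\ (forall k i, a k 0 i <= b k 0 i),
        A `<=` \bigcup_(k in D) box (a k) (b k) &
        s = (\esum_(k in D) (box_volume (a k) (b k))%:E)%E]].

Lemma lebesgue_outer_ge0 A : (0 <= lebesgue_outer A)%E.
Proof.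
apply: le_ereal_inf_tmp => _ [D [a [b [ab _ ->]]]].
by apply: esum_ge0 => k _; rewrite lee_fin prodr_ge0// => i _; rewrite subr_ge0.
Qed.

Lemma lebesgue_outer0 : lebesgue_outer set0 = 0%E.
Proof.
apply/eqP; rewrite eq_le lebesgue_outer_ge0 andbT.
apply: ereal_inf_lbound; exists set0, (fun=> 0), (fun=> 0).
by split=> //; rewrite esum_set0.
Qed.

Lemma le_lebesgue_outer :
  {homo lebesgue_outer : A B / A `<=` B >-> (A <= B)%E}.
Proof.
move=> A B AB; apply: ereal_inf_le_tmp => _ [D [a [b [ab BD ->]]]].
by exists D, a, b; split=> //; exact: subset_trans BD.
Qed.

Lemma lebesgue_outer_sigma_subadditive : sigma_subadditive lebesgue_outer.
Proof.
move=> A; have [[n Anoo]|] := pselect (exists n, lebesgue_outer (A n) = +oo%E).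
  rewrite (eseries_pinfty _ _ Anoo) ?leey// => k _.
  by rewrite -ltNye (lt_le_trans _ (lebesgue_outer_ge0 _)).
rewrite -forallNE => Afin.
apply/lee_addgt0Pr => e e0.
rewrite (le_trans _ (epsilon_trick _ _ (ltW e0)))//; last first.
  by move=> n; exact: lebesgue_outer_ge0.
pose P n (c : set nat * (nat -> 'rV[R]_d) * (nat -> 'rV[R]_d)) :=
  [/\ (forall k i, c.1.2 k 0 i <= c.2 k 0 i),
      A n `<=` \bigcup_(k in c.1.1) box (c.1.2 k) (c.2 k) &
      (\esum_(k in c.1.1) (box_volume (c.1.2 k) (c.2 k))%:E
       <= lebesgue_outer (A n) + (e / (2 ^ n.+1)%:R)%:E)%E].
have [c Pc] : {c & forall n, P n (c n)}.
  apply: (@choice _ _ P) => n.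
  have fA : lebesgue_outer (A n) \is a fin_num.
    by rewrite ge0_fin_numE ?lebesgue_outer_ge0// ltey; apply/eqP/Afin.
  have e2 : 0 < e / (2 ^ n.+1)%:R :> R.
    by rewrite divr_gt0// ltr0n expn_gt0.
  have [_ [D [a [b [ab AD ->]]]] /ltW le] := lb_ereal_inf_adherent e2 fA.
  by exists (D, a, b).
have /card_esym/ppcard_eqP[f] := card_nat2.
pose g := (f : nat -> nat * nat).
pose vol (p : nat * nat) :=
  (box_volume ((c p.1).1.2 p.2) ((c p.1).2 p.2))%:E.
have vol0 p : (0 <= vol p)%E.
  rewrite lee_fin prodr_ge0// => i _; rewrite subr_ge0.
  by have [] := Pc p.1.
pose Q := [set p : nat * nat | (c p.1).1.1 p.2].
apply: (@le_trans _ _ (\esum_(p in Q) vol p)%E).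
  apply: ereal_inf_lbound.
  exists (g @^-1` Q), (fun k => (c (g k).1).1.2 (g k).2),
    (fun k => (c (g k).1).2 (g k).2); split.
  - by move=> k i; have [] := Pc (g k).1.
  - move=> x [n _ Anx]; have [_ /(_ _ Anx)[m Dm xm] _] := Pc n.
    have gf : g (f^-1%FUN (n, m)) = (n, m) by rewrite /g invK ?inE.
    by exists (f^-1%FUN (n, m)); rewrite /= ?gf.
  - apply: reindex_esum; split=> //.
    + by move=> j k _ _; apply: inj; rewrite inE.
    + move=> p Qp; have gf : g (f^-1%FUN p) = p by rewrite /g invK ?inE.
      by exists (f^-1%FUN p); rewrite /= ?gf.
have -> : Q = setT `*`` (fun n => (c n).1.1).
  by apply/seteqP; split=> -[n m] //= [].
rewrite -(@esum_esum _ _ _ setT _ (fun n m => vol (n, m)))//.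
rewrite -nneseries_esumT; last by move=> n; exact: esum_ge0.
apply: lee_nneseries => [n _ _|n _]; last by have [] := Pc n.
by apply: esum_ge0 => m _; exact: vol0.
Qed.

HB.instance Definition _ := isOuterMeasure.Build R 'rV[R]_d lebesgue_outer
  lebesgue_outer0 lebesgue_outer_ge0 le_lebesgue_outer
  lebesgue_outer_sigma_subadditive.

End euclidean_space.
Arguments unit_cube : clear implicits.

(* R^d with the sigma-algebra of Lebesgue measurable sets, on which
   lebesgue_outer is Lebesgue measure. *)
Notation lebesgue_space R d :=
  (caratheodory_type (@lebesgue_outer R d)).

Definition lebesgue_measure_Rn {R : realType} {d : nat} :
  set (lebesgue_space R d) -> \bar R := @lebesgue_outer R d.

HB.instance Definition _ (R : realType) (d : nat) :=
  isMeasure.Build _ (lebesgue_space R d) R (@lebesgue_measure_Rn R d)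
    (@caratheodory_measure0 _ _ (@lebesgue_outer R d))
    (@caratheodory_measure_ge0 _ _ (@lebesgue_outer R d))
    (@caratheodory_measure_sigma_additive _ _ (@lebesgue_outer R d)).

Section rectifiability.
Context {R : realType} {disp : measure_display}.
Context {M : measurableMetricType disp R} {d : nat}.
Implicit Types (mu : {measure set M -> \bar R}).
Implicit Types (nu : {measure set (lebesgue_space R d) -> \bar R}).
Implicit Types (O : set 'rV[R]_d) (f : 'rV[R]_d -> M).

Definition lipschitz_bound O f (c : R) : Prop :=
  forall x y, O x -> O y -> mdist (f x) (f y) <= c * euclidean_norm (x - y).

(* The infimum is attained when a bound exists. Nonnegativity of c only matters
   when O has at most one point. *)
Definition Lip O f : R := inf [set c | 0 <= c /\ lipschitz_bound O f c].

(* The map f is a total function of which only the restriction to O matters.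
   A measure on the unit cube is a measure on R^d that vanishes off the cube.
   The preimages f^-1(E `&` f(O)) are measurable for the completion of nu, so
   that mu may be a Borel measure as well as the completion of one; likewise
   the complement of f(O) is required to be mu-negligible, which for a complete
   mu means measurable of measure zero. *)
Record rectifiable_by mu nu O f : Prop := RectifiableBy {
  rect_nu_cube : nu (~` unit_cube R d) = 0%E ;
  rect_nu_ac : nu `<< @lebesgue_measure_Rn R d ;
  rect_dom_measurable : measurable (O : set (lebesgue_space R d)) ;
  rect_dom_cube : O `<=` unit_cube R d ;
  rect_inj : set_inj O f ;
  rect_lipschitz : exists c : R, lipschitz_bound O f c ;
  rect_full : mu.-negligible (~` (f @` O)) ;
  rect_pushforward : forall E : set M, measurable E ->
    let preim := O `&` f @^-1` (E `&` f @` O) in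
    (nu^*)%mu.-cara.-measurable preim /\
    mu E = @completed_measure_extension _ _ _ nu preim }.

Definition diam (V : set M) : R :=
  sup [set r | exists y1 y2, [/\ V y1, V y2 & r = mdist y1 y2]].

Record equal_measure_partition mu (N : nat) (V : 'I_N -> set M) : Prop :=
  EqualMeasurePartition {
    emp_measurable : forall i, measurable (V i) ;
    emp_cover : mu (~` \bigcup_i V i) = 0%E ;
    emp_disjoint : forall i j, i != j -> mu (V i `&` V j) = 0%E ;
    emp_measure : forall i, mu (V i) = (N%:R^-1)%:E }.

Definition average_diameter (N : nat) (V : 'I_N -> set M) : R :=
  N%:R^-1 * \sum_i diam (V i).

End rectifiability.

(* Main.v *)
(** Cutting a probability measure by d real functions with values in [0, 1] and
    null level sets into N cells of equal measure: with x = N^(1/d), cut along the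
    last function into ceil x <= 2 x slabs whose masses are nearly equal multiples
    of 1/N, and cut each slab recursively along the remaining functions.  If the
    cell widths are summed over all functions and cells, the last function
    contributes at most max_j N_j <= 2 x^(d-1), where N_j is the number of cells of
    the j-th slab, and the recursive bounds (d-1) 2^(d-2) N_j^((d-2)/(d-1)) add up
    by concavity to at most (d-1) 2^(d-1) x^(d-1).

    On M the functions are the coordinates of the inverse of f.  They are
    measurable because a measurable O is, up to a Lebesgue null set, a countable
    union of compact sets, whose images under f are compact.  Their level sets are
    null because nu vanishes on hyperplanes.  The Lipschitz condition turns cell
    widths into diameters, the Euclidean norm being at most the l^1 norm. *)

Require Import Defs.
From HB Require Import structures.
From mathcomp Require Import all_boot all_order all_algebra.
From mathcomp Require Import all_classical all_reals all_analysis.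
From mathcomp Require Import ring lra zify.

Set Implicit Arguments.
Unset Strict Implicit.
Unset Printing Implicit Defensive.

Import Order.TTheory GRing.Theory Num.Theory.
Import numFieldNormedType.Exports.

Local Open Scope classical_set_scope.
Local Open Scope ring_scope.

(** * Power means and balanced splitting of a finite index set *)

(** AM-GM for one copy of x^(k+1) and k copies of y^(k+1). The step from k to k+1 multiplies by y
    and adds (y^(k+1) - x^(k+1)) (y - x) >= 0. *)
Lemma weighted_AMGM_expr (R : realDomainType) (k : nat) (x y : R) :
  0 <= x -> 0 <= y ->
  (k.+1)%:R * (x * y ^+ k) <= k%:R * y ^+ k.+1 + x ^+ k.+1.
Proof.
move=> x0 y0; elim: k => [|k IH]; first by rewrite !expr0 !expr1; lra.
have mono : 0 <= (y ^+ k.+1 - x ^+ k.+1) * (y - x).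
  have [xy|/ltW yx] := leP x y.
    by rewrite mulr_ge0// subr_ge0// lerXn2r.
  by rewrite mulr_le0// subr_le0// lerXn2r.
have := ler_wpM2l y0 IH.
rewrite -(natr1 k.+1) -(natr1 k).
move: mono; rewrite !exprS; move: (x ^+ k) (y ^+ k) (k%:R : R) => a b c.
nra.
Qed.

(** The labels [h] will distribute the cells over the slabs. One fiber is peeled off at a time so
    that the two-sided bound on the remaining cardinal survives with m lowered by one. *)
Lemma balanced_fibers (I : finType) (m q : nat) (J : {set I}) :
  (q * m <= #|J| <= q.+1 * m)%N ->
  exists h : I -> nat, (forall i, i \in J -> (h i < m)%N) /\
    forall j, (j < m)%N ->
      (q <= #|[set i in J | h i == j]%SET| <= q.+1)%N.
Proof.
elim: m J => [|m IH] J qJ.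
  exists (fun=> 0%N); split=> // i iJ.
  by move: qJ; rewrite !muln0 leqn0 cards_eq0 => /andP[_ /eqP J0]; rewrite J0 inE in iJ.
(* Size of the last fiber: q+1 if at least q * m elements then remain, and q otherwise. *)
have [k [kJ kq]] : exists k, (k <= #|J|)%N /\
    [&& (q <= k <= q.+1)%N, (q * m <= #|J| - k)%N & (#|J| - k <= q.+1 * m)%N].
  have [qm|qm] := leqP (q.+1 + q * m) #|J|; [exists q.+1|exists q]; lia.
pose J0 := [set x in take k (enum J)]%SET.
have cJ0 : #|J0| = k.
  rewrite cardsE (card_uniqP _) ?take_uniq ?enum_uniq// size_takel//.
  by rewrite -cardE.
have sJ0 : J0 \subset J.
  by apply/fintype.subsetP => i; rewrite inE => /mem_take; rewrite mem_enum.
have [|h [hm hq]] := IH (J :\: J0)%SET.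
  by rewrite cardsDS// cJ0; case/and3P : kq => _ -> ->.
exists (fun i => if i \in J0 then m else h i); split.
  move=> i iJ; case: ifPn => // iJ0.
  by rewrite ltnS ltnW// hm// inE iJ0.
move=> j; rewrite ltnS leq_eqVlt => /predU1P[->|jm].
  suff -> : [set i in J | (if i \in J0 then m else h i) == m]%SET = J0.
    by rewrite cJ0; case/and3P : kq.
  apply/setP => i; rewrite inE; case: ifPn => iJ0.
    by rewrite eqxx andbT (fintype.subsetP sJ0).
  apply/negbTE; rewrite negb_and -implybE; apply/implyP => iJ.
  by rewrite neq_ltn hm// inE iJ0.
rewrite (_ : finset _ = [set i in J :\: J0 | h i == j]%SET) ?hq//.
apply/setP => i; rewrite !inE; case: ifPn => iJ0 /=; last by [].
by rewrite (gtn_eqF jm) andbF.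
Qed.

Lemma sum_fibers (V : nmodType) (I : finType) (m : nat) (J : {set I})
    (h : I -> nat) (F : I -> V) :
  (forall i, i \in J -> (h i < m)%N) ->
  \sum_(i in J) F i =
  \sum_(j < m) \sum_(i in [set i in J | h i == j]%SET) F i.
Proof.
move=> hm; rewrite (exchange_big_dep (mem J))/=; last first.
  by move=> j i _; rewrite inE => /andP[].
apply: eq_bigr => i iJ.
rewrite (big_pred1 (Ordinal (hm _ iJ)))// => j.
by rewrite inE iJ/= eq_sym.
Qed.

Lemma natr_root_exists (R : realType) (n k : nat) :
  exists y : R, 0 <= y /\ y ^+ k.+1 = n%:R.
Proof.
exists (n%:R `^ k.+1%:R^-1); rewrite powR_ge0; split=> //.
by rewrite -powR_mulrn ?powR_ge0// -powRrM mulVf// powRr1.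
Qed.

(** * Cutting a measure along functions with null level sets *)

Section cutting.
Context {d : measure_display} {T : measurableType d} {R : realType}.
Context (mu : {measure set T -> \bar R}).
Implicit Types (A : set T) (p : T -> R).

Lemma bigcap_sublevel A p (t : R) :
  \bigcap_n (A `&` [set x | p x < t + n.+1%:R^-1]) =
  (A `&` [set x | p x < t]) `|` (A `&` [set x | p x = t]).
Proof.
apply/seteqP; split=> x xL; last first.
  move=> n _; case: xL => -[Ax /= xt]; split => //=; last by rewrite xt ltrDl.
  by apply: lt_trans xt _; rewrite ltrDl.
have Ax : A x by case: (xL 0%N I).
have [xt|tx|xt] := ltgtP (p x) t; [by left| |by right].
have [n xn] := ltr_add_invr tx.
by have [_ /=] := xL n I; rewrite ltNge (ltW xn).
Qed.

Lemma measurable_level A p (t : R) :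
  (forall t, measurable (A `&` [set x | p x < t])) ->
  measurable (A `&` [set x | p x = t]).
Proof.
move=> mp; rewrite (_ : _ `&` _ =
    (\bigcap_n (A `&` [set x | p x < t + n.+1%:R^-1])) `\` (A `&` [set x | p x < t])).
  by apply: measurableD => //; exact: bigcapT_measurable.
rewrite bigcap_sublevel; apply/seteqP; split=> [x [Ax /= xt]|x [[|]]//].
by split; [right|case; rewrite /= xt ltxx].
Qed.

(** An intermediate value theorem: the mass of the sublevel set is nondecreasing in t and, the level
    sets being null, continuous. The cut is the supremum of the t whose sublevel mass is at most
    s. *)
Lemma exists_sublevel_measure A p (a b s : R) :
  measurable A -> (forall t, measurable (A `&` [set x | p x < t])) ->
  (forall t, mu (A `&` [set x | p x = t]) = 0%E) ->
  (forall x, A x -> a <= p x <= b) ->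
  (mu A < +oo)%E -> 0 <= s -> (s%:E <= mu A)%E -> a <= b ->
  exists2 t, a <= t <= b & mu (A `&` [set x | p x < t]) = s%:E.
Proof.
move=> mA mp p0 Aab Aoo s0 sA ab.
pose L t := A `&` [set x | p x < t].
pose S := [set t | a <= t <= b /\ (mu (L t) <= s%:E)%E].
have Sa : S a.
  split; first by rewrite lexx.
  rewrite (_ : L a = set0) ?measure0// -subset0 => x [/Aab/andP[]] /=.
  by move=> ax _; rewrite ltNge ax.
have ubS : ubound S b by move=> t [/andP[]].
have hS : has_sup S by split; [exists a|exists b].
have LS u v : u <= v -> L u `<=` L v.
  by move=> uv x [Ax] /= xu; split => //=; exact: lt_le_trans uv.
have mL_le u v : u <= v -> (mu (L u) <= mu (L v))%E.
  by move=> uv; apply: le_measure; rewrite ?inE; [exact: mp|exact: mp|exact: LS].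
set t := sup S.
have at_ : a <= t by exact: (ub_le_sup hS.2).
have tb : t <= b by exact: ge_sup hS.1 ubS.
exists t; first by rewrite at_.
have below u : u < t -> (mu (L u) <= s%:E)%E.
  move=> ut; have [v [_ vs] uv] := sup_gt hS.1 ut.
  by apply: le_trans vs; apply: mL_le; exact: ltW.
have above u : t < u -> (s%:E <= mu (L u))%E.
  (* Beyond b the sublevel set is all of A, whose mass is at least s. *)
  move=> tu; have [ub|bu] := leP u b; last first.
    rewrite (_ : L u = A)//; apply/seteqP; split=> [x []//|x Ax].
    by split => //=; case/andP: (Aab _ Ax) => _ xb; exact: le_lt_trans bu.
  rewrite leNgt; apply/negP => /ltW us.
  have : u <= t.
    apply: (ub_le_sup hS.2); split=> //.
    by rewrite ub (le_trans at_ (ltW tu)).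
  by rewrite leNgt tu.
apply/eqP; rewrite eq_le; apply/andP; split.
  (* Left continuity gives the upper bound on the mass at t. *)
  have E : L t = \bigcup_n L (t - n.+1%:R^-1).
    apply/seteqP; split=> [x [Ax] /= xt|x [n _]]; last first.
      by apply: LS; rewrite gerBl.
    have [n xn] := ltr_add_invr xt.
    by exists n => //; split => //=; rewrite ltrBrDr.
  have := @nondecreasing_cvg_mu _ _ _ mu (fun n => L (t - n.+1%:R^-1)).
  rewrite -E => /(_ (fun=> mp _) (mp _)) cv.
  have {}cv := cv _.
  have : nondecreasing_seq (fun n => L (t - n.+1%:R^-1)).
    move=> m n mn; apply/subsetPset; apply: LS.
    by rewrite lerD2l lerN2 lef_pV2 ?posrE// ler_nat.
  move=> /cv {}cv; apply: (cvge_le _ cv).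
  by apply: nearW => n /=; apply: below; rewrite gtrBl.
(* The limit from the right differs from [L t] by a null level set; continuity from above, valid as
   [mu A] is finite, gives the lower bound. *)
have E : \bigcap_n L (t + n.+1%:R^-1) = L t `|` (A `&` [set x | p x = t]).
  exact: bigcap_sublevel.
have mE : measurable (A `&` [set x | p x = t]) by exact: measurable_level.
have <- : mu (\bigcap_n L (t + n.+1%:R^-1)) = mu (L t).
  by rewrite E measureU0//; exact: mp.
have cv : mu (L (t + n.+1%:R^-1)) @[n --> \oo] --> mu (\bigcap_n L (t + n.+1%:R^-1)).
  apply: nonincreasing_cvg_mu.
  - apply: le_lt_trans Aoo; apply: le_measure; rewrite ?inE.
    + exact: (mp (t + 1%:R^-1)).
    + exact: mA.
    + by move=> x [].
  - by move=> n; exact: (mp (t + n.+1%:R^-1)).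
  - by apply: bigcapT_measurable => n; exact: mp.
  - move=> m n mn; apply/subsetPset; apply: LS.
    by rewrite lerD2l lef_pV2 ?posrE// ler_nat.
apply: (cvge_ge _ cv); apply: nearW => n /=.
by apply: above; rewrite ltrDl.
Qed.

(** The last slab is cut off at a level t and the rest, with range [a, t], is treated by induction.
    The last width is b - t, so the widths telescope to at most b - a. *)
Lemma slab_partition A p (m : nat) (s : nat -> R) (a b : R) :
  measurable A -> (forall t, measurable (A `&` [set x | p x < t])) ->
  (forall t, mu (A `&` [set x | p x = t]) = 0%E) ->
  (forall x, A x -> a <= p x <= b) -> a <= b ->
  (forall j, 0 <= s j) -> mu A = (\sum_(j < m) s j)%:E ->
  exists (U : nat -> set T) (w : nat -> R),
    [/\ forall j, (j < m)%N -> [/\ measurable (U j), U j `<=` A & mu (U j) = (s j)%:E],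
        forall j x y, (j < m)%N -> U j x -> U j y -> `|p x - p y| <= w j,
        \sum_(j < m) w j <= b - a, (forall j, 0 <= w j) &
        forall i j, (i < j < m)%N -> U i `&` U j = set0].
Proof.
move=> + + + + + s0; elim: m A b => [|m IH] A b mA mp p0 Aab ab muA.
  exists (fun=> set0), (fun=> 0); split=> //.
  - by rewrite big_ord0 subr_ge0.
  - by move=> i j; rewrite ltn0 andbF.
have sm0 : 0 <= \sum_(j < m) s j by exact: sumr_ge0.
have [||t /andP[at_ tb] mut] :=
    exists_sublevel_measure mA mp p0 Aab (s := \sum_(j < m) s j) _ sm0 _ ab.
- by rewrite muA ltry.
- by rewrite muA lee_fin big_ord_recr/= lerDl.
pose A1 := A `&` [set x | p x < t].
have mA1 : measurable A1 by exact: mp.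
have AI (B : set T) : A1 `&` B = (A `&` B) `&` A1.
  by apply/seteqP; split=> x; rewrite /A1 /=; tauto.
have [||x|//|//|U [w [Us wU sw w0 dU]]] := IH A1 t mA1.
- move=> u; rewrite AI; apply: measurableI => //; exact: mp.
- move=> u; rewrite AI.
  have mE := measurable_level u mp.
  apply: subset_measure0 (p0 u) => //; exact: measurableI.
- by move=> [Ax /= /ltW ->]; case/andP: (Aab _ Ax) => ->.
pose U' j := if j == m then A `\` A1 else U j.
pose w' j := if j == m then b - t else w j.
have E (j : 'I_m) : (j == m :> nat) = false by rewrite ltn_eqF.
exists U', w'; split.
- move=> j; rewrite /U' ltnS leq_eqVlt; case: eqP => [-> _|_ /= jm].
    split; [exact: measurableD|by move=> x []|].
    have -> : mu (A `\` A1) = (mu A - mu A1)%E.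
      rewrite measureD//; last by rewrite -[X in (X < _)%E]/(mu A) muA ltry.
      by rewrite (_ : A `&` A1 = A1)//; apply: setIidr => x [].
    by rewrite muA /A1 mut big_ord_recr/= -EFinB addrC addrK.
  by have [mU UA1 ->] := Us _ jm; split=> // x /UA1[].
- move=> j x y; rewrite /U' /w' ltnS leq_eqVlt; case: eqP => [_ _|_ /= jm]; last exact: wU.
  move=> [Ax nx] [Ay ny].
  have tx : t <= p x by rewrite leNgt; apply/negP => xt; apply: nx.
  have ty : t <= p y by rewrite leNgt; apply/negP => yt; apply: ny.
  move: (Aab _ Ax) (Aab _ Ay) => /andP[_ xb] /andP[_ yb].
  by rewrite ler_norml; lra.
- rewrite big_ord_recr/= /w' eqxx (eq_bigr (fun j : 'I_m => w j)).
    by move: sw; lra.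
  by move=> j _; rewrite E.
- by move=> j; rewrite /w'; case: eqP => // _; rewrite subr_ge0.
- move=> i j /andP[ij]; rewrite /U' ltnS leq_eqVlt => /predU1P[jm|jm].
    rewrite jm eqxx; have im : (i < m)%N by rewrite -jm.
    rewrite (ltn_eqF im) -subset0 => x [Ux [_]]; apply.
    by have [_ UA _] := Us _ im; exact: UA.
  by rewrite (ltn_eqF jm) (ltn_eqF (ltn_trans ij jm)) dU ?ij.
Qed.

(** Cells are indexed by a subset [J] of a fixed type so that the recursion can pass to the fibers
    of a labelling; the cell mass [c] never changes. [w i] bounds the l^1 oscillation of the k+1
    functions on a cell. *)
Lemma grid_partition (k : nat) (I : finType) (J : {set I}) (p : nat -> T -> R)
    A (c x : R) :
  measurable A -> (forall l t, measurable (A `&` [set y | p l y < t])) ->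
  (forall l t, mu (A `&` [set y | p l y = t]) = 0%E) ->
  (forall l y, A y -> 0 <= p l y <= 1) ->
  0 <= c -> mu A = (#|J|%:R * c)%:E -> 0 <= x -> x ^+ k.+1 = #|J|%:R ->
  exists (V : I -> set T) (w : I -> R),
    [/\ forall i, i \in J -> [/\ measurable (V i), V i `<=` A & mu (V i) = c%:E],
        forall i y z, i \in J -> V i y -> V i z ->
          \sum_(l < k.+1) `|p l y - p l z| <= w i,
        \sum_(i in J) w i <= k.+1%:R * 2 ^+ k * x ^+ k &
        forall i j, i \in J -> j \in J -> i != j -> V i `&` V j = set0].
Proof.
move=> + + + + c0; elim: k J A x => [|k IH] J A x mA mp p0 p01 muA x0 xJ.
  have [|U [w [Us wU sw _ dU]]] := slab_partition (m := #|J|) (s := fun=> c)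
      mA (mp 0%N) (p0 0%N) (p01 0%N) ler01 (fun=> c0).
    by rewrite muA sumr_const card_ord mulr_natl.
  (* With a single function the slabs are the cells, numbered by position in [enum J]. *)
  pose r i := index i (enum J).
  have rJ i : i \in J -> (r i < #|J|)%N.
    by move=> iJ; rewrite cardE index_mem mem_enum.
  exists (U \o r), (w \o r); split=> //=.
  - by move=> i iJ; apply: Us; exact: rJ.
  - by move=> i y z iJ Uy Uz; rewrite big_ord1; apply: wU Uy Uz; exact: rJ.
  - rewrite subr0 in sw; rewrite !expr0 !mulr1; apply: le_trans sw.
    rewrite big_enum_val/=.
    rewrite le_eqVlt; apply/orP; left; apply/eqP; apply: eq_bigr => j _.
    by rewrite /r /enum_val index_uniq ?enum_uniq// -cardE.
  - move=> i j iJ jJ ij; have [ri|rj|rij] := ltngtP (r i) (r j).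
    + by apply: dU; rewrite ri rJ.
    + by rewrite setIC; apply: dU; rewrite rj rJ.
    + move/eqP : ij; case; rewrite -(nth_index i (s := enum J) (x := i)) ?mem_enum//.
      by rewrite -/(r i) rij nth_index ?mem_enum.
(* An empty [J] would allow x = 0; otherwise x >= 1, which the rounding below relies on. *)
have [/eqP J0|Jn0] := eqVneq #|J| 0%N.
  rewrite cards_eq0 in J0; move/eqP : J0 => J0.
  exists (fun=> set0), (fun=> 0); rewrite J0; split=> [i|i y z|| i j].
  - by rewrite inE.
  - by rewrite inE.
  - by rewrite big_set0 !mulr_ge0 ?exprn_ge0.
  - by rewrite inE.
have x1 : 1 <= x.
  rewrite leNgt; apply/negP => xl1.
  have : x ^+ k.+2 < 1 by rewrite exprn_ilt1.
  by rewrite xJ ltNge ler1n lt0n Jn0.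
(* The number of slabs is the ceiling of x, below x + 1 <= 2 x. *)
have [m [xm m2x]] : exists m : nat, x <= m%:R /\ m%:R <= 2 * x.
  have /andP[h1 h2] := ceil_itv x.
  have c0' : (0 <= Num.ceil x)%R by rewrite ceil_ge0 (lt_le_trans _ x0)// ltrN10.
  exists `|Num.ceil x|%N; rewrite -[X in x <= X]mulr1n natr_absz ger0_norm//; split=> //.
  by move: h1; rewrite intrD/=; lra.
have m0 : (0 < m)%N by rewrite -(ltr_nat R) (lt_le_trans _ xm)// (lt_le_trans ltr01).
have [|h [hm hq]] := @balanced_fibers I m (#|J| %/ m) J.
  by rewrite leq_divM/= ltnW// ltn_ceil.
pose Jj j := [set i in J | h i == j]%SET.
have [||U [w1 [Us wU sw w1_ge0 dU]]] := slab_partition (m := m)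
    (s := fun j => #|Jj j|%:R * c) mA (mp k.+1) (p0 k.+1) (p01 k.+1) ler01.
- by move=> j; rewrite mulr_ge0.
- rewrite muA; congr (_%:E); rewrite -mulr_suml -natr_sum; congr (_%:R * _).
  by rewrite -sum1_card (sum_fibers _ hm); apply: eq_bigr => j _; rewrite sum1_card.
have /choice[y yP] : forall j, exists y : R, 0 <= y /\ y ^+ k.+1 = #|Jj j|%:R.
  by move=> j; exact: natr_root_exists.
(* The induction hypothesis cuts slab j into the cells of fiber [Jj j]; measurability and null level
   sets pass to subsets [U j] of A. For j >= m any value will do. *)
have /choice[Vw VwP] : forall j, exists Vw : (I -> set T) * (I -> R), (j < m)%N ->
   [/\ forall i, i \in Jj j -> [/\ measurable (Vw.1 i), Vw.1 i `<=` U j & mu (Vw.1 i) = c%:E],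
        forall i y z, i \in Jj j -> Vw.1 i y -> Vw.1 i z ->
          \sum_(l < k.+1) `|p l y - p l z| <= Vw.2 i,
        \sum_(i in Jj j) Vw.2 i <= k.+1%:R * 2 ^+ k * y j ^+ k &
        forall i j', i \in Jj j -> j' \in Jj j -> i != j' -> Vw.1 i `&` Vw.1 j' = set0].
  move=> j; have [jm|] := ltnP j m; last by exists (fun=> set0, fun=> 0).
  have [mU UA muU] := Us _ jm.
  have UI B : U j `&` B = A `&` B `&` U j.
    apply/seteqP; split=> z /= [Uz Bz]; last by case: Uz.
    by split=> //; split=> //; exact: UA.
  have mlev l t : measurable (U j `&` [set y | p l y < t]).
    by rewrite UI; exact: measurableI.
  have [||V [w' [? ? ? ?]]] := IH (Jj j) (U j) (y j) mU mlev _ _ muU (yP j).1 (yP j).2.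
  - move=> l t; apply: subset_measure0 (p0 l t).
    + exact: measurable_level.
    + exact: measurable_level.
    + by move=> z [/UA].
  - by move=> l z /UA; exact: p01.
  by exists (V, w').
have hJ i : i \in J -> i \in Jj (h i) by move=> iJ; rewrite inE iJ eqxx.
exists (fun i => (Vw (h i)).1 i), (fun i => (Vw (h i)).2 i + w1 (h i)); split.
- move=> i iJ; have [/(_ _ (hJ _ iJ))[mV VU muV] _ _ _] := VwP _ (hm _ iJ).
  by split=> //; apply: (subset_trans VU); have [] := Us _ (hm _ iJ).
- move=> i z z' iJ Vz Vz'.
  have [/(_ _ (hJ _ iJ))[_ VU _] /(_ _ _ _ (hJ _ iJ) Vz Vz') VV _ _] := VwP _ (hm _ iJ).
  by rewrite big_ord_recr/= lerD// (wU (h i))// ?hm//; exact: VU.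
- have ySum : \sum_(j < m) y j ^+ k <= 2 * x ^+ k.+1.
    (* Jensen's inequality for t^(k/(k+1)), via AM-GM against the mean. *)
    have le_mx : \sum_(j < m) y j ^+ k <= m%:R * x ^+ k.
      have kx0 : 0 < k.+1%:R * x by rewrite mulr_gt0// (lt_le_trans ltr01).
      rewrite -(ler_pM2l kx0) mulr_sumr.
      apply: (@le_trans _ _ (\sum_(j < m) (k%:R * y j ^+ k.+1 + x ^+ k.+1))).
        apply: ler_sum => j _; rewrite -mulrA.
        by apply: weighted_AMGM_expr => //; exact: (yP j).1.
      rewrite big_split/= -mulr_sumr sumr_const card_ord -mulr_natl.
      have -> : \sum_(j < m) y j ^+ k.+1 = x ^+ k.+2.
        rewrite xJ (eq_bigr (fun j : 'I_m => #|Jj j|%:R)); last first.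
          by move=> j _; exact: (yP j).2.
        rewrite -natr_sum -sum1_card (sum_fibers _ hm); congr (_%:R).
        by apply: eq_bigr => j _; rewrite sum1_card.
      have := ler_wpM2r (exprn_ge0 k.+1 x0) xm.
      rewrite !exprS -natr1 => /(ler_wpM2l (ler0n R k)).
      by lra.
    apply: (le_trans le_mx); rewrite exprS mulrA ler_wpM2r// exprn_ge0//.
  (* A slab has at most q + 1 cells, where q <= x^(k+2) / m <= x^(k+1) because m >= x. *)
  have q2x : (#|J| %/ m).+1%:R <= 2 * x ^+ k.+1.
    have x1k : 1 <= x ^+ k.+1 by rewrite exprn_ege1.
    have : (#|J| %/ m)%:R <= x ^+ k.+1.
      have m0' : 0 < m%:R :> R by rewrite ltr0n.
      rewrite -(ler_pM2r m0') -natrM.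
      apply: (@le_trans _ _ (#|J|%:R)); first by rewrite ler_nat leq_divM.
      by rewrite -xJ exprSr ler_wpM2l// exprn_ge0.
    by rewrite -natr1; lra.
  rewrite (sum_fibers _ hm).
  (* Slab j contributes its recursive bound, plus its own width once for each of its cells. *)
  apply: (@le_trans _ _ (\sum_(j < m) (k.+1%:R * 2 ^+ k * y j ^+ k +
      (#|J| %/ m).+1%:R * w1 j))).
    apply: ler_sum => j _; have [_ _ V2 _] := VwP _ (ltn_ord j).
    rewrite (eq_bigr (fun i => (Vw j).2 i + w1 j)); last first.
      by move=> i; rewrite inE => /andP[_ /eqP ->].
    rewrite big_split/=; apply: lerD; first exact: V2.
    rewrite sumr_const -[leLHS]mulr_natl ler_wpM2r// ler_nat.
    by have /andP[] := hq _ (ltn_ord j).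
  rewrite big_split/= -!mulr_sumr subr0 in sw *.
  have h1 := ler_wpM2l (mulr_ge0 (ler0n R k.+1) (exprn_ge0 k (ler0n R 2))) ySum.
  have h2 : (#|J| %/ m).+1%:R * (\sum_(j < m) w1 j) <= 2 * x ^+ k.+1.
    apply: le_trans q2x; rewrite -[leRHS]mulr1 ler_wpM2l//.
  (* The slab widths cost 2 x^(k+1), which fits in the increment 2^(k+1) x^(k+1) of the bound. *)
  have e2 : 1 <= 2 ^+ k :> R by rewrite exprn_ege1// ler1n.
  have h3 := ler_wpM2r (exprn_ge0 k.+1 x0) e2.
  apply: (le_trans (lerD h1 h2)).
  by rewrite -(natr1 k.+1) (exprS 2 k); lra.
- move=> i j iJ jJ ij; have [hij|hij|hij] := ltngtP (h i) (h j).
  + rewrite -subset0 -(dU (h i) (h j)) ?hij ?hm//; apply: setISS.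
    * by have [/(_ _ (hJ _ iJ))[] ] := VwP _ (hm _ iJ).
    * by have [/(_ _ (hJ _ jJ))[] ] := VwP _ (hm _ jJ).
  + rewrite setIC -subset0 -(dU (h j) (h i)) ?hij ?hm//; apply: setISS.
    * by have [/(_ _ (hJ _ jJ))[] ] := VwP _ (hm _ jJ).
    * by have [/(_ _ (hJ _ iJ))[] ] := VwP _ (hm _ iJ).
  + have [_ _ _ dV] := VwP _ (hm _ iJ).
    by rewrite -hij dV// ?hJ// hij hJ.
Qed.

End cutting.

(** * Inner regularity of Lebesgue measure in the unit cube *)

Section lebesgue_regularity.
Context {R : realType} {d : nat}.
Local Notation lam := (@lebesgue_outer R d).
Implicit Types (a b x : 'rV[R]_d) (A O : set 'rV[R]_d).

(** The enlarged volume is a polynomial in r, each side growing by 2 r, hence continuous at 0. *)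
Lemma enlarged_box_volume a b (e : R) : 0 < e -> exists2 r, 0 < r &
  box_volume (a - const_mx r) (b + const_mx r) <= box_volume a b + e.
Proof.
move=> e0; pose P : {poly R} := \prod_(i < d) ((b 0 i - a 0 i)%:P + 'X *+ 2).
have PE r : P.[r] = box_volume (a - const_mx r) (b + const_mx r).
  rewrite horner_prod; apply: eq_bigr => i _.
  by rewrite hornerD hornerC hornerMn hornerX !mxE; lra.
have P0 : P.[0] = box_volume a b.
  by rewrite PE; apply: eq_bigr => i _; rewrite !mxE; lra.
have /cvgrPdist_lt /(_ _ e0) := @continuous_horner R P 0.
move=> /nbhs_ballP[r /= r0 rP]; exists (r / 2); first by rewrite divr_gt0.
have /= := rP (r / 2); rewrite /ball/= sub0r normrN gtr0_norm ?divr_gt0//.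
rewrite gtr_pMr// invf_lt1// ltr1n => /(_ isT).
by rewrite P0 PE ltr_norml; lra.
Qed.

Lemma open_box_open a b : open [set x : 'rV[R]_d | forall i, a 0 i < x 0 i < b 0 i].
Proof.
rewrite openE => x xab.
have xI := @filter_forall _ 'I_d (fun i (y : 'rV[R]_d) => a 0 i < y 0 i < b 0 i) (nbhs x) _.
apply: xI => i.
pose I : set R := `]a 0 i, b 0 i[%classic.
have oI : open ((fun y : 'rV[R]_d => y 0 i) @^-1` I).
  by apply: open_comp => [y _|]; [exact: coord_continuous|exact: itv_open].
have : nbhs x ((fun y : 'rV[R]_d => y 0 i) @^-1` I).
  by apply: open_nbhs_nbhs; split=> //=; rewrite /I/= in_itv; exact: xab.
by apply: filterS => y; rewrite /I/= in_itv.
Qed.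

Lemma lebesgue_outer_box_le a b : (forall i, a 0 i <= b 0 i) ->
  (lam (box a b) <= (box_volume a b)%:E)%E.
Proof.
move=> ab; apply: ereal_inf_lbound.
exists [set 0%N], (fun=> a), (fun=> b); split=> //.
- by rewrite bigcup_set1.
- by rewrite esum_set1// lee_fin prodr_ge0// => i _; rewrite subr_ge0.
Qed.

Lemma compact_unit_cube : compact (unit_cube R d).
Proof.
rewrite (_ : unit_cube R d = [set x | forall i, `[0, 1]%classic (x ord0 i)]).
  by apply: (@rV_compact R d (fun=> `[0, 1]%classic)) => i; exact: segment_compact.
by apply/seteqP; split=> x /= + i => /(_ i); rewrite !mxE /= in_itv.
Qed.

(** The slice lies in a degenerate box whose i-th side has length 0. *)
Lemma lebesgue_outer_unit_cube_slice i (t : R) :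
  lam (unit_cube R d `&` [set x : 'rV[R]_d | x 0 i = t]) = 0%E.
Proof.
apply/eqP; rewrite eq_le outer_measure_ge0 andbT.
pose a : 'rV[R]_d := \row_j (if j == i then t else 0).
pose b : 'rV[R]_d := \row_j (if j == i then t else 1).
apply: (@le_trans _ _ (lam (box a b))).
  apply: le_outer_measure => x [cx /= xi] j; rewrite !mxE.
  by case: eqP => [->|_]; [rewrite xi lexx|have := cx j; rewrite !mxE].
apply: le_trans (lebesgue_outer_box_le _) _.
  by move=> j; rewrite !mxE; case: ifP.
by rewrite lee_fin /box_volume (bigD1 i)//= !mxE eqxx subrr mul0r.
Qed.

(* Closed boxes covering the complement of O in the cube are enlarged to open
   ones; Caratheodory's condition for O, tested on their union, bounds the part
   of O that they cover. *)
Lemma compact_inner_approx O (e : R) : 0 < e ->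
  measurable (O : set (lebesgue_space R d)) -> O `<=` unit_cube R d ->
  exists K, [/\ compact K, K `<=` O & (lam (O `\` K) <= e%:E)%E].
Proof.
move=> e0 mO OQ; pose C := unit_cube R d `\` O.
have Cfin : lam C \is a fin_num.
  rewrite ge0_fin_numE ?outer_measure_ge0//.
  apply: (@le_lt_trans _ _ (lam (unit_cube R d))).
    by apply: le_outer_measure => x [].
  apply: le_lt_trans (ltry _); apply: lebesgue_outer_box_le => i.
  by rewrite !mxE.
(* Half of e is spent on a nearly optimal cover, half on enlarging its boxes, with geometric
   weights. *)
have e2 : 0 < e / 2 by rewrite divr_gt0.
have [_ [D [a [b [ab CD ->]]]] ltC] := lb_ereal_inf_adherent e2 Cfin.
have /choice[r rP] k : exists r, 0 < r /\
    box_volume (a k - const_mx r) (b k + const_mx r) <=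
    box_volume (a k) (b k) + e / 2 / (2 ^ k.+1)%:R.
  have [|r r0 rP] := enlarged_box_volume (a k) (b k) (e := e / 2 / (2 ^ k.+1)%:R).
    by rewrite divr_gt0// ltr0n expn_gt0.
  by exists r.
pose a' k := a k - const_mx (r k); pose b' k := b k + const_mx (r k).
have ab' k i : a' k 0 i <= b' k 0 i.
  by rewrite !mxE; have [/ltW] := rP k; have := ab k i; lra.
pose U := \bigcup_(k in D) [set x : 'rV[R]_d | forall i, a' k 0 i < x 0 i < b' k 0 i].
have oU : open U by apply: bigcup_open => k _; exact: open_box_open.
have CU : C `<=` U.
  move=> x /CD[k Dk xk]; exists k => // i; rewrite !mxE.
  by have [r0 _] := rP k; have /andP[] := xk i; lra.
have lamU : (lam U <= lam C + e%:E)%E.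
  apply: (@le_trans _ _ (\esum_(k in D) (box_volume (a' k) (b' k))%:E)%E).
    apply: ereal_inf_lbound; exists D, a', b'; split => // x [k Dk xk].
    by exists k => // i; have /andP[/ltW -> /ltW] := xk i.
  have vol0 k : (0 <= (box_volume (a k) (b k))%:E)%E.
    by rewrite lee_fin prodr_ge0// => i _; rewrite subr_ge0.
  have vol0' k : (0 <= (box_volume (a' k) (b' k))%:E)%E.
    by rewrite lee_fin prodr_ge0// => i _; rewrite subr_ge0.
  have toD (v : nat -> \bar R) : (forall k, (0 <= v k)%E) ->
      (\esum_(k in D) v k = \sum_(k <oo | k \in D) v k)%E.
    move=> v0; rewrite nneseries_esum//; congr (esum _ _).
    by apply/seteqP; split=> k /=; rewrite inE.
  rewrite toD//; apply: (@le_trans _ _ (\sum_(k <oo | k \in D)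
      ((box_volume (a k) (b k))%:E + (e / 2 / (2 ^ k.+1)%:R)%:E))%E).
    by apply: lee_nneseries => k *; [exact: vol0'|rewrite -EFinD lee_fin; exact: (rP k).2].
  apply: le_trans (epsilon_trick _ vol0 (ltW e2)) _.
  rewrite -toD// [e in leRHS]splitr EFinD addeA leeD2r//.
  exact: ltW.
exists (unit_cube R d `\` U); split.
- apply: (subclosed_compact _ compact_unit_cube); last by move=> x [].
  apply: closedI; last exact: open_closedC.
  exact: compact_closed (@norm_hausdorff _ _) compact_unit_cube.
- move=> x [Qx nUx]; apply: contrapT => nOx; apply: nUx; exact: CU.
- rewrite (_ : O `\` _ = U `&` O); last first.
    apply/seteqP; split=> x [].
      by move=> Ox nK; split=> //; apply: contrapT => nU; apply: nK; split=> //; exact: OQ.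
    by move=> Ux Ox; split=> // -[].
  rewrite -(@leeD2rE _ (lam C))// addeC [leRHS]addeC.
  apply: le_trans lamU; rewrite (mO U) addeC leeD2l//.
  by apply: le_outer_measure => x Cx; split; [exact: CU|case: Cx].
Qed.

Lemma lebesgue_outer_negligible_measurable A : lam A = 0%E ->
  measurable (A : set (lebesgue_space R d)).
Proof.
move=> A0; apply: le_caratheodory_measurable => X.
rewrite [Y in (Y + _)%E](_ : _ = 0%E) ?add0e; first by apply: le_outer_measure => x [].
apply/eqP; rewrite eq_le outer_measure_ge0 andbT -A0.
by apply: le_outer_measure => x [].
Qed.

(** [K n] misses at most 1/(n+1) of [O], so the union misses less than any e. *)
Lemma sigma_compact_inner_approx O :
  measurable (O : set (lebesgue_space R d)) -> O `<=` unit_cube R d ->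
  exists K : nat -> set 'rV[R]_d, [/\ forall n, compact (K n),
    forall n, K n `<=` O & lam (O `\` \bigcup_n K n) = 0%E].
Proof.
move=> mO OQ.
have /choice[K KP] n : exists K, [/\ compact K, K `<=` O &
    (lam (O `\` K) <= (n.+1%:R^-1)%:E)%E].
  by apply: compact_inner_approx; rewrite // invr_gt0.
exists K; split=> [n|n|]; [by case: (KP n)|by case: (KP n)|].
apply/eqP; rewrite eq_le outer_measure_ge0 andbT.
apply/lee_addgt0Pr => e e0; rewrite add0e.
have [n ne] := ltr_add_invr e0; rewrite add0r in ne.
have [_ _ Kn] := KP n.
apply: (@le_trans _ _ (lam (O `\` K n))).
  by apply: le_outer_measure => x [Ox nK]; split=> // Kx; apply: nK; exists n.
by apply: le_trans Kn _; rewrite lee_fin ltW.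
Qed.

End lebesgue_regularity.

(** * Lipschitz constants and diameters *)

Section lipschitz.
Context {R : realType} {disp : measure_display}.
Context {M : measurableMetricType disp R} {d : nat}.
Implicit Types (O K : set 'rV[R]_d) (f : 'rV[R]_d -> M).

Lemma euclidean_norm_le_sum (x : 'rV[R]_d) :
  euclidean_norm x <= \sum_i `|x 0 i|.
Proof.
have s0 : 0 <= \sum_i `|x 0 i| by exact: sumr_ge0.
rewrite -(ger0_norm s0) -sqrtr_sqr ler_sqrt ?sqr_ge0// expr2 mulr_suml.
apply: ler_sum => i _; rewrite -real_normK ?num_real// expr2 ler_wpM2l//.
by rewrite (bigD1 i)//= lerDl sumr_ge0.
Qed.

Lemma Lip_ge0 O f : 0 <= Lip O f.
Proof.
rewrite /Lip; set S := [set _ | _].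
(* Without any Lipschitz bound, [Lip] is the default value 0 of [inf]. *)
have [->|/set0P S0] := eqVneq S set0; first by rewrite inf0.
by apply: lb_le_inf => // c [].
Qed.

(** For a fixed pair of points the inequality is a lower bound on c after division by the norm, so
    it passes to the infimum. *)
Lemma lipschitz_bound_Lip O f :
  (exists c, lipschitz_bound O f c) -> lipschitz_bound O f (Lip O f).
Proof.
move=> [c0 fc0] x y Ox Oy.
have n0 : 0 <= euclidean_norm (x - y) by exact: sqrtr_ge0.
have [e0|en0] := eqVneq (euclidean_norm (x - y)) 0.
  by have := fc0 _ _ Ox Oy; rewrite e0 !mulr0.
have ngt0 : 0 < euclidean_norm (x - y) by rewrite lt_def en0.
rewrite -ler_pdivrMr//; apply: lb_le_inf => [|c [_ fc]]; last first.
  by rewrite ler_pdivrMr//; exact: fc.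
(* The given bound may be negative, whereas [Lip] ranges over nonnegative ones. *)
exists (Num.max c0 0); split; first by rewrite le_max lexx orbT.
move=> u v Ou Ov; apply: le_trans (fc0 _ _ Ou Ov) _.
by rewrite ler_wpM2r ?sqrtr_ge0// le_max lexx.
Qed.

Lemma lipschitz_within_continuous O K f c : lipschitz_bound O f c -> K `<=` O ->
  {within K, continuous f}.
Proof.
move=> fc KO; apply/subspace_continuousP => x Kx.
apply/metricType_numDomainType.cvgrPdist_lt => e e0.
(* Balls are those of the sup norm, and the Euclidean norm is at most d times it, so D must exceed d
   |c|; the final 1 keeps D positive when d = 0. *)
pose D : R := d%:R * (`|c| + 1) + 1.
have D0 : 0 < D by rewrite /D ltr_wpDl// mulr_ge0// addr_ge0.
rewrite near_withinE; apply/nbhs_ballP; exists (e / D) => /=; first by rewrite divr_gt0.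
move=> y xy Ky; apply: le_lt_trans (fc _ _ (KO _ Kx) (KO _ Ky)) _.
have sxy : euclidean_norm (x - y) <= d%:R * (e / D).
  apply: le_trans (euclidean_norm_le_sum _) _.
  rewrite -[d in leRHS]card_ord -sumr_const mulr_suml; apply: ler_sum => i _.
  by rewrite mul1r !mxE ltW//; case: xy => _; exact.
apply: (@le_lt_trans _ _ (`|c| * (d%:R * (e / D)))).
  apply: (@le_trans _ _ (`|c| * euclidean_norm (x - y))).
    by rewrite ler_wpM2r ?sqrtr_ge0// ler_norm.
  by rewrite ler_wpM2l.
rewrite !mulrA ltr_pdivrMr// /D.
have := ler0n R d; have := normr_ge0 c; nra.
Qed.

Lemma diam_le (V : set M) (r : R) : 0 <= r ->
  (forall y z, V y -> V z -> mdist y z <= r) -> diam V <= r.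
Proof.
move=> r0 Vr; rewrite /diam.
set S := [set _ | _]; have [->|/set0P S0] := eqVneq S set0; first by rewrite sup0.
by apply: ge_sup => // _ [y [z [Vy Vz ->]]]; exact: Vr.
Qed.

End lipschitz.

(** * Transport of null sets and measurability through [f] *)

Section rectifiable.
Context {R : realType} {disp : measure_display}.
Context {M : measurableMetricType disp R} {d : nat}.
Context (mu : {measure set M -> \bar R}).
Context (nu : {measure set (lebesgue_space R d) -> \bar R}).
Context (O : set 'rV[R]_d) (f : 'rV[R]_d -> M).
Context (M_borel : forall U : set M, open U -> measurable U).
Context (rect : rectifiable_by mu nu O f).

Lemma image_compact_measurable K : compact K -> K `<=` O -> measurable (f @` K).
Proof.
move=> cK KO; have [c fc] := rect_lipschitz rect.
have : compact (f @` K).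
  by apply: continuous_compact => //; exact: lipschitz_within_continuous fc KO.
move=> /(compact_closed (@metric_hausdorff R M)) clo.
rewrite -(setCK (f @` K)); apply: measurableC; apply: M_borel.
exact: closed_openC.
Qed.

(** By injectivity, the preimage in [rect_pushforward] is [A] itself. *)
Lemma measure_image A : A `<=` O -> measurable (f @` A) ->
  mu (f @` A) = (nu^*)%mu A.
Proof.
move=> AO mA; have [_ ->] := rect_pushforward rect mA.
congr ((nu^*)%mu _); apply/seteqP; split=> x; last first.
  by move=> Ax; do !split; [exact: AO|exists x|exists x => //; exact: AO].
move=> [Ox [[y Ay fyx] _]].
by rewrite -(rect_inj rect _ _ fyx) ?inE//; exact: AO.
Qed.

(** Lebesgue null sets are measurable, so [nu^*] equals [nu] on them and absolute continuity
    applies. *)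
Lemma outer_negligible A : @lebesgue_outer R d A = 0%E -> (nu^*)%mu A = 0%E.
Proof.
move=> A0; have mA := lebesgue_outer_negligible_measurable A0.
rewrite measurable_mu_extE//.
apply: (rect_nu_ac rect (t := A)) => // B mB BA.
apply/eqP; rewrite eq_le measure_ge0 andbT -A0.
exact: le_outer_measure BA.
Qed.

End rectifiable.

(** * The partition cut by the coordinates of the inverse of [f] *)

Theorem theorem4p1 (R : realType) (disp : measure_display)
  (M : measurableMetricType disp R)
  (M_compact : compact [set: M])
  (M_borel : forall U : set M, open U -> measurable U)
  (mu : {measure set M -> \bar R})
  (mu1 : mu [set: M] = 1%E)
  (d : nat) (d_gt0 : (0 < d)%N)
  (nu : {measure set (lebesgue_space R d) -> \bar R})
  (O : set 'rV[R]_d) (f : 'rV[R]_d -> M)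
  (rect : rectifiable_by mu nu O f)
  (N : nat) (N_gt0 : (1 <= N)%N) :
  exists V : 'I_N -> set M,
    equal_measure_partition mu V /\
    average_diameter V <=
      d%:R * 2 ^+ (d - 1) * Lip O f * N%:R `^ (- d%:R^-1).
Proof.
have [mO OQ] := (rect_dom_measurable rect, rect_dom_cube rect).
have [K [cK KO lamK]] := sigma_compact_inner_approx mO OQ.
(* For closed [C] this is a countable union of images of compact sets, hence measurable. *)
pose F (C : set 'rV[R]_d) := f @` (\bigcup_n K n `&` C).
have KCO C : \bigcup_n K n `&` C `<=` O by move=> x [[n _ /KO]].
have mF C : closed C -> measurable (F C).
  move=> clC; rewrite /F setI_bigcupl image_bigcup.
  apply: bigcupT_measurable => n; apply: (image_compact_measurable M_borel rect).
    exact: compact_closedI.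
  by move=> x [/KO].
have muF C : closed C -> mu (F C) = (nu^*)%mu (\bigcup_n K n `&` C).
  by move=> clC; apply: (measure_image rect) => //; exact: mF.
pose A := F setT.
have mA : measurable A by apply: mF; exact: closedT.
(* The total mass 1 is [nu^*] of [O], and [O] exceeds the union of the [K n] by a null set only. *)
have muA : mu A = 1%E.
  apply/eqP; rewrite eq_le; apply/andP; split.
    by rewrite -mu1; apply: le_measure; rewrite ?inE.
  have [_] := rect_pushforward rect measurableT.
  rewrite mu1 setTI (_ : O `&` _ = O); last first.
    by apply/seteqP; split=> [x []//|x Ox]; split=> //; exists x.
  move=> ->; rewrite muF; last exact: closedT.
  rewrite -[leRHS]adde0 -(outer_negligible rect lamK) setIT.
  apply: le_trans (outer_measureU2 _ _ _); apply: le_outer_measure => x Ox.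
  by have [Kx|nKx] := pselect ((\bigcup_n K n) x); [left|right].
case: d d_gt0 => [//|k] _ in nu O f rect mO OQ K cK KO lamK F KCO mF muF A mA muA *.
have /choice[g gP] y : exists x, A y -> (\bigcup_n K n) x /\ f x = y.
  have [[x [Kx _] fxy]|nAy] := pselect (A y); last by exists 0.
  by exists x.
pose p (l : nat) y := g y 0 (inord l : 'I_k.+1).
(* As [g] inverts [f] on [A], conditions on [p l] become conditions on a coordinate in the cube. *)
have AF (P : set R) l : A `&` [set y | P (p l y)] =
    F [set x : 'rV[R]_k.+1 | P (x 0 (inord l))].
  apply/seteqP; split=> y.
    by move=> [/gP[Kg fg] Py]; exists (g y).
  move=> [x [Kx Px] <-].
  have Afx : A (f x) by exists x.
  have [Kg fg] := gP _ Afx.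
  suff gx : g (f x) = x by split=> //=; rewrite /p gx.
  by apply: (rect_inj rect) => //; rewrite inE; apply: (KCO setT).
have clP (P : set R) l : closed P -> closed [set x : 'rV[R]_k.+1 | P (x 0 (inord l))].
  move=> clP; apply: (@preimage_closed _ _ (fun x : 'rV[R]_k.+1 => x 0 (inord l)) P) => //.
  by move=> x _; exact: coord_continuous.
have mp l t : measurable (A `&` [set y | p l y < t]).
  (* [mF] handles closed conditions, so the strict sublevel set is obtained as a complement. *)
  rewrite (_ : _ `&` _ = A `\` (A `&` [set y | t <= p l y])); last first.
    apply/seteqP; split=> y /= [Ay]; rewrite ltNge.
      by move=> /negP npy; split=> // -[].
    by move=> npy; split=> //; apply/negP => py; apply: npy.
  apply: measurableD => //; rewrite (AF [set r | t <= r]).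
  by apply: mF; apply: (clP [set r | t <= r]); exact: closed_ge.
have p0 l t : mu (A `&` [set y | p l y = t]) = 0%E.
  rewrite (AF [set t]) muF; last by apply: (clP [set t]); exact: closed_eq.
  apply: (outer_negligible rect).
  apply/eqP; rewrite eq_le outer_measure_ge0 andbT.
  rewrite -(@lebesgue_outer_unit_cube_slice R k.+1 (inord l) t).
  by apply: le_outer_measure => x [[n _ /KO /OQ Qx] xt].
have p01 l y : A y -> 0 <= p l y <= 1.
  by move=> /gP[[n _ /KO /OQ /(_ (inord l))]]; rewrite !mxE.
have [x [x0 xN]] := @natr_root_exists R N k.
have N0 : 0 < N%:R :> R by rewrite ltr0n.
have [|||V [w [VP Vw sw dV]]] := @grid_partition _ _ _ mu k 'I_N [set: 'I_N]%SET p A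
    N%:R^-1 x mA mp p0 p01 _ _ x0.
- by rewrite invr_ge0 ltW.
- by rewrite muA cardsT card_ord divff// gt_eqF.
- by rewrite cardsT card_ord.
have {}VP i := VP i (finset.in_setT i).
have triv : trivIset [set: 'I_N] V.
  apply/trivIsetP => i j _ _; exact: dV.
exists V; split.
  split=> [i|||i]; [by have [] := VP i| | |by have [] := VP i].
  (* N disjoint cells of mass 1/N fill the total mass 1, so their complement is null. *)
  - pose B := \big[setU/set0]_(i < N) V i.
    have mV i : measurable (V i) by have [] := VP i.
    have mB : measurable B by exact: bigsetU_measurable.
    have muB : mu B = 1%E.
      rewrite measure_bigsetU_ord//.
      rewrite (eq_bigr (fun=> (N%:R^-1)%:E)); last by move=> i _; have [] := VP i.
      rewrite sumEFin sumr_const card_ord; congr (_%:E).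
      by rewrite -[LHS]mulr_natl divff// gt_eqF.
    have BV : B `<=` \bigcup_i V i.
      apply: (big_ind (fun B => B `<=` \bigcup_i V i)) => //.
        by move=> B1 B2 B1V B2V; rewrite subUset.
      by move=> i _; exact: bigcup_sup.
    have mU : measurable (\bigcup_i V i) by exact: fin_bigcup_measurable.
    apply: (@subset_measure0 _ _ _ mu _ (~` B)); [exact: measurableC|exact: measurableC| |].
      exact: subsetC.
    rewrite -setTD measureD//; last by rewrite -[X in (X < _)%E]/(mu setT) mu1 ltry.
    by rewrite setTI -[X in (X - _)%E]/(mu setT) -[X in (_ - X)%E]/(mu B) mu1 muB subee.
  - by move=> i j ij; rewrite dV// measure0.
have L0 := Lip_ge0 O f.
have diamV i : diam (V i) <= Lip O f * w i.
  have lipV y z : V i y -> V i z -> mdist y z <= Lip O f * w i.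
    move=> Vy Vz; have [_ VA _] := VP i.
    have [[Ky fy] [Kz fz]] := (gP _ (VA _ Vy), gP _ (VA _ Vz)).
    rewrite -{1}fy -{1}fz.
    apply: (le_trans (lipschitz_bound_Lip (rect_lipschitz rect) _ _)).
    + exact: (KCO setT).
    + exact: (KCO setT).
    apply: ler_wpM2l => //; apply: le_trans (euclidean_norm_le_sum _) _.
    apply: le_trans (Vw i y z (finset.in_setT i) Vy Vz).
    apply: ler_sum => l _; rewrite /p !mxE.
    by rewrite inord_val.
  apply: diam_le => //; apply: mulr_ge0 => //.
  (* [diam_le] asks for a nonnegative bound; a cell has positive mass, hence a point, and there
     [w i] dominates a sum of absolute values. *)
  have [y Vy] : V i !=set0.
    apply/set0P/negP => /eqP V0; have [_ _] := VP i.
    rewrite V0 measure0 => -[] /esym/eqP.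
    by rewrite invr_eq0 gt_eqF.
  by apply: le_trans (Vw i y y (finset.in_setT i) Vy Vy); exact: sumr_ge0.
have xne0 : x != 0.
  by apply/eqP => x00; move: N0; rewrite -xN x00 expr0n ltxx.
have xE : N%:R `^ (- k.+1%:R^-1) = x^-1.
  by rewrite -xN -powR_mulrn// -powRrM mulrN mulfV// powRN powRr1.
have Ni0 : 0 <= N%:R^-1 :> R by rewrite invr_ge0 ltW.
rewrite xE /average_diameter subn1/=.
apply: (@le_trans _ _ (N%:R^-1 * (Lip O f * \sum_i w i))).
  apply: ler_wpM2l => //; rewrite mulr_sumr; apply: ler_sum => i _; exact: diamV.
apply: (@le_trans _ _ (N%:R^-1 * (Lip O f * (k.+1%:R * 2 ^+ k * x ^+ k)))).
  apply: ler_wpM2l => //; apply: ler_wpM2l => //.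
  apply: le_trans sw; rewrite le_eqVlt; apply/orP; left; apply/eqP.
  by apply: eq_bigl => i; rewrite inE.
(* Since N = x^(k+1), dividing x^k by N leaves 1/x, which is N^(-1/d). *)
rewrite -xN exprS le_eqVlt; apply/orP; left; apply/eqP.
by field; rewrite xne0 expf_neq0.
Qed.
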